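(* Let $n\geq 5$ be odd. Let $\Psi$ be an instance of $\{1,2\}$-CSP whose graph $G$ is connected and bipartite, with its vertices properly coloured black and white, and assume $\mathbf{P}_\infty\models\Psi$. Then the following are equivalent: (I) $\mathbf{P}_n\models\Psi$; (II) Prover has a winning strategy in the game $\mathscr{G}(\Psi,\mathbf{P}_n)$; (III) there are no vertices $u,v$ with $\gamma'(u)\geq\frac{n-1}{2}$ and $\gamma'(v)\geq\frac{n-1}{2}$ such that $u$ is black and $v$ is white.
   Context: $\mathbf{P}_n$ is the path on $\{1,\ldots,n\}$, $\mathbf{P}_\infty$ the path on $\mathbb{Z}$ (edges between integers at distance 1). An instance $\Psi$ of $\{1,2\}$-CSP is a sentence in which each variable $v$ is quantified by $\exists^{\geq\beta(v)}$, $\beta(v)\in\{1,2\}$ ($\exists^{\geq j}$: at least $j$ distinct elements), followed by a conjunction of atoms $E(v_i,v_k)$; $G$ is the graph on the variables with an edge for each atom and $\prec$ the quantification order; for sets $X\prec Y$ means $x\prec y$ for all $x\in X,y\in Y$. Game $\mathscr{G}(\Psi,\mathbf{B})$: in order $\prec$, for each $v$ Prover offers $\beta(v)$ distinct elements of $\mathbf{B}$ and Adversary picks one as $f(v)$; Prover wins if $f$ is a homomorphism $G\to\mathbf{B}$. For a walk $Q=x_1,\ldots,x_r$, $|Q|=r-1$ and $\lambda(Q)=|Q|-2\sum_{i=2}^{r-1}(\beta(x_i)-1)$. A walk is looping if $x_1\neq x_r$ and, when $r\geq 3$, $\{x_1,x_r\}\prec\{x_2,\ldots,x_{r-1}\}$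 and there is $\ell\notin\{1,r\}$ with $x_1,\ldots,x_\ell$ and $x_\ell,\ldots,x_r$ both looping (for $r=2$: two distinct adjacent vertices). $\delta(u,v)$ is the minimum $\lambda(Q)$ over looping walks with endpoints $u,v$, and $\infty$ if none. $\gamma'$ is defined recursively along $\prec$ for every vertex (including the first) by $\gamma'(v)=\beta(v)-1+\max\{0,\max_{u\prec v}(\gamma'(u)-\delta(u,v)+\beta(v)-1)\}$, where the inner maximum over an empty set, or over terms with $\delta(u,v)=\infty$, is $-\infty$; in particular $\gamma'(v)=\beta(v)-1$ for the first vertex. *)

(* Defs.v *)
From HB Require Import structures.
From mathcomp Require Import all_boot all_order all_algebra.
From mathcomp Require Import boolp classical_sets constructive_ereal.
From mathcomp Require Import zify.
Set Implicit Arguments.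
Unset Strict Implicit.
Unset Printing Implicit Defensive.
Import Order.TTheory GRing.Theory Num.Theory.
Local Open Scope ring_scope.

(* The variables are listed in the order of quantification, so the order on   *)
(* them is the order of the ordinals.                                         *)
Record instance := Instance {
  nvar : nat;
  beta : 'I_nvar -> nat;
  beta_12 : forall v, beta v \in [:: 1; 2]%N;
  atoms : seq ('I_nvar * 'I_nvar)
}.

Definition at_least (B : eqType) (j : nat) (P : B -> Prop) : Prop :=
  exists s : seq B, [/\ uniq s, size s = j & forall x, x \in s -> P x].

Section Semantics.
Variables (B : eqType) (E : rel B) (Psi : instance).
Local Notation V := 'I_(nvar Psi).

(* [vs] lists the variables that remain to be quantified. *)
Fixpoint holds_from (vs : seq V) (f : V -> B) : Prop :=
  match vs with
  | [::] => forall e, e \in atoms Psi -> E (f e.1) (f e.2)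
  | v :: vs' =>
      at_least (beta v) (fun b => holds_from vs' [eta f with v |-> b])
  end.

(* Truth of a sentence, i.e., satisfaction under every assignment; the        *)
(* initial assignment is irrelevant since every variable is quantified.       *)
Definition models : Prop := forall f : V -> B, holds_from (enum V) f.

Definition adj : rel V :=
  [rel u v : V | ((u, v) \in atoms Psi) || ((v, u) \in atoms Psi)].

Definition homomorphism (f : V -> B) : Prop :=
  forall u v, adj u v -> E (f u) (f v).

(* A strategy maps a variable v and the list of Adversary's picks for the     *)
(* variables before v to the elements offered at v.                           *)
Definition strategy := V -> seq B -> seq B.

Definition history (f : V -> B) (v : V) : seq B :=
  [seq f u | u : V <- enum V & (u < v)%N].

Definition legal (sigma : strategy) : Prop :=
  forall (v : V) (h : seq B), size h = v ->
    uniq (sigma v h) /\ size (sigma v h) = beta v.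

Definition play_of (sigma : strategy) (f : V -> B) : Prop :=
  forall v, f v \in sigma v (history f v).

Definition Prover_wins : Prop :=
  exists2 sigma : strategy, legal sigma &
    forall f, play_of sigma f -> homomorphism f.

End Semantics.

(* The vertices 1, ..., n are represented by 0, ..., n - 1. *)
Definition path_graph (n : nat) : rel 'I_n :=
  [rel i j : 'I_n | (i.+1 == j :> nat) || (j.+1 == i :> nat)].
Arguments path_graph : clear implicits.

Definition path_Z : rel int := [rel i j : int | `|i - j| == 1].

Section Weights.
Variable Psi : instance.
Local Notation V := 'I_(nvar Psi).

Definition connected : Prop := forall u v : V, connect (@adj Psi) u v.

Definition proper_colouring (black : pred V) : Prop :=
  forall u v : V, adj u v -> black u != black v.

(* A walk x_1, ..., x_r is given by x = x_1 and p = [:: x_2; ...; x_r]; its    *)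
(* last vertex is [last x p] and its length is [size p].                      *)
Definition interior (x : V) (p : seq V) : seq V := behead (belast x p).

Definition lambda (x : V) (p : seq V) : int :=
  (size p)%:Z - 2 * \sum_(z <- interior x p) ((beta z)%:Z - 1).

(* In [looping_cat] the two parts have at least two vertices each, so they    *)
(* meet at a vertex whose index is neither 1 nor r.                           *)
Inductive looping : V -> seq V -> Prop :=
| looping_edge x y : adj x y -> x != y -> looping x [:: y]
| looping_cat x p q :
    x != last x (p ++ q) ->
    (forall z, z \in interior x (p ++ q) ->
       (x < z)%N /\ (last x (p ++ q) < z)%N) ->
    looping x p -> looping (last x p) q -> looping x (p ++ q).

Definition looping_weight (u v : V) (d : int) : Prop :=
  exists p, [/\ looping u p, last u p = v & lambda u p = d].

Definition least_weight (u v : V) (d : int) : Prop :=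
  looping_weight u v d /\ forall d', looping_weight u v d' -> d <= d'.

(* The minimum of a nonempty set of weights exists; see [delta_cases]. *)
Definition delta (u v : V) : \bar int :=
  xget +oo%E [set d%:E | d in [set d | least_weight u v d]]%classic.

Lemma looping_size x p : looping x p ->
  (size p <= 2 ^ (nvar Psi - maxn x (last x p)))%N.
Proof.
elim=> {x p} [x y _ _|x p q _ lt_int lp IHp lq IHq].
  by rewrite expn_gt0.
have p_gt0 : forall y r, looping y r -> (0 < size r)%N.
  by move=> y r; elim=> // a r1 r2 _ _ _ r1gt0 _ _; rewrite size_cat addn_gt0 r1gt0.
rewrite size_cat last_cat in lt_int *.
set y := last x p in lt_int lq IHp IHq *; set z := last y q in lt_int IHq *.
have y_int : y \in interior x (p ++ q).
  rewrite /interior.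
  case: p lp @y lq {IHp IHq lt_int z} => [/p_gt0 //|a p] _ y /p_gt0.
  by case: q => // b q _; rewrite /= belast_cat mem_cat /= mem_head orbT.
have [xy zy] := lt_int _ y_int.
have yn := ltn_ord y.
have bound k : (k <= 2 ^ (nvar Psi - y) ->
    k * 2 <= 2 ^ (nvar Psi - maxn x z))%N.
  move=> ky; apply: (@leq_trans (2 ^ (nvar Psi - y) * 2)); first by rewrite leq_mul2r ky.
  rewrite -expnSr leq_exp2l //; lia.
rewrite (maxn_idPr (ltnW xy)) in IHp; rewrite (maxn_idPl (ltnW zy)) in IHq.
apply: leq_trans (bound _ (leqnn _)).
by rewrite muln2 -addnn leq_add.
Qed.

Lemma looping_weight_ge u v d : looping_weight u v d ->
  - (2 * 2 ^ nvar Psi)%N%:Z <= d.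
Proof.
case=> p [/looping_size lp _ <-].
have {}lp : (size p <= 2 ^ nvar Psi)%N.
  by apply: leq_trans lp _; rewrite leq_exp2l // leq_subr.
have si : (size (interior u p) <= size p)%N.
  by rewrite /interior size_behead size_belast leq_pred.
have : \sum_(z <- interior u p) ((beta z)%:Z - 1) <= (size (interior u p))%:Z.
  elim: (interior u p) => [|z s IH]; first by rewrite big_nil.
  rewrite big_cons /=.
  rewrite -add1n PoszD lerD //.
  by have := beta_12 z; rewrite !inE => /orP[] /eqP ->.
rewrite /lambda; lia.
Qed.

Lemma delta_cases (u v : V) :
  (exists2 d, least_weight u v d & delta u v = d%:E) \/
  ((forall d, ~ looping_weight u v d) /\ delta u v = +oo%E).
Proof.
have [[d0 d0P]|no] := pselect (exists d, looping_weight u v d); last first.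
  have {}no d : ~ looping_weight u v d by move=> dP; apply: no; exists d.
  right; split=> //; rewrite /delta xgetPN // => x [d /= [dP _] _].
  exact: no dP.
left; pose c := (2 * 2 ^ nvar Psi)%N.
pose P (k : nat) : bool := `[< looping_weight u v (k%:Z - c%:Z) >].
have PE d : looping_weight u v d -> exists2 k : nat, P k & d = k%:Z - c%:Z.
  move=> dP; have := looping_weight_ge dP; rewrite -/c => cd.
  have kE : d = (absz (d + c%:Z))%:Z - c%:Z by lia.
  by exists (absz (d + c%:Z)); rewrite // /P -kE; apply/asboolP.
have exP : exists k, P k by have [k Pk _] := PE _ d0P; exists k.
case: (ex_minnP exP) => k /asboolP kP kmin.
have lw : least_weight u v (k%:Z - c%:Z).
  split=> // d /PE[k' /kmin kk' ->]; lia.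
exists (k%:Z - c%:Z) => //; rewrite /delta.
case: xgetP => [x -> [d /= [dP dmin] <-]|/(_ (k%:Z - c%:Z)%:E)]; last first.
  by case; exists (k%:Z - c%:Z).
by congr (_%:E); apply/eqP; rewrite eq_le (dmin _ kP) (lw.2 _ dP).
Qed.

(* Recursion along the order, with fuel k > v; see [gamma'E]. *)
Fixpoint gamma'_rec (k : nat) (v : V) : \bar int :=
  if k is k'.+1 then
    (((beta v)%:Z - 1)%:E +
     maxe 0 (\big[maxe/-oo]_(u : V | (u < v)%N)
               (gamma'_rec k' u - delta u v + ((beta v)%:Z - 1)%:E)))%E
  else 0%E.

Definition gamma' (v : V) : \bar int := gamma'_rec v.+1 v.

Lemma gamma'E (v : V) :
  gamma' v =
    (((beta v)%:Z - 1)%:E +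
     maxe 0 (\big[maxe/-oo]_(u : V | (u < v)%N)
               (gamma' u - delta u v + ((beta v)%:Z - 1)%:E)))%E.
Proof.
have rec_stable k (w : V) : (w < k)%N -> gamma'_rec k w = gamma' w.
  rewrite /gamma'; elim: k {-2}k (leqnn k) w => [|K IH] k.
    by rewrite leqn0 => /eqP ->.
  case: k => // k; rewrite ltnS => kK w; rewrite ltnS => wk /=.
  congr (_ + maxe _ _)%E; apply: eq_bigr => u uw.
  by rewrite (IH k) ?(leq_trans uw) // (IH w) // (leq_trans wk kK).
rewrite {1}/gamma' /=; congr (_ + maxe _ _)%E.
by apply: eq_bigr => u uv; rewrite rec_stable.
Qed.

End Weights.

(* Main.v *)
(* Place P_n on the integers -m, ..., m with n = 2m + 1.                       *)
(* Adversary: if the endpoints of a looping walk Q are placed at distance      *)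
(* more than lambda(Q), or with the wrong parity, then the violation passes to *)
(* one of the two halves of Q when their common vertex is placed, and finally  *)
(* to an edge. Hence Adversary may assume |f u - f v| <= delta(u, v), and by   *)
(* always choosing the pick farther from the centre he forces                  *)
(* |f v| >= gamma' v. If a black and a white vertex both have gamma' >= m, one *)
(* of them must be placed at a position of the parity opposite to m, hence     *)
(* strictly beyond m.                                                          *)
(* Prover: she keeps |f u - f v| <= delta(u, v) and |f v| <= gamma' v rounded  *)
(* up to the parity of the colour of v, giving the parity of m to the colour   *)
(* allowed to reach m. The admissible values of v form pairwise overlapping    *)
(* intervals, as concatenating looping walks bounds delta, so Helly's theorem  *)
(* on the line leaves beta v of them.                                          *)
Require Import Defs.
From mathcomp Require Import all_boot all_order all_algebra.
From mathcomp Require Import boolp constructive_ereal.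
From mathcomp Require Import zify.
(* Otherwise [looping] would denote the one of path.v. *)
Import Defs.
Set Implicit Arguments.
Unset Strict Implicit.
Unset Printing Implicit Defensive.
Import Order.TTheory GRing.Theory Num.Theory.
Local Open Scope ring_scope.

(** Truth of the sentence is a game read backwards, so (I) and (II) differ only by a choice of
    offers. The rest shows that [delta] and [gamma'] capture all that matters in a position.
    Necessity: while Prover can still win, placed vertices u, v are at distance at most [delta u v],
    with the parity of that weight ([looping_distance]), and Adversary can force v to distance
    [gamma' v] from the centre ([Adversary_forces]). In a won play on a connected bipartite graph
    the first pick fixes the parity of the position of every vertex, so only one colour can sit at
    the ends -m and m ([models_gamma'_lt]). Sufficiency: these bounds, with [gamma'] rounded to the
    right parity, form an invariant that Prover can maintain ([safe_values]). The intervals to be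
    intersected overlap pairwise by three facts: the recursion for [gamma'], concatenation of
    looping walks ([weight_cat]), and [weight_ge_excess], which extracts from truth on the infinite
    path that a single distance interval has room for the required offers. *)

(** * Looping walks, their weights, and the recursion for [gamma'] *)

Section Walks.
Variable Psi : instance.
Local Notation V := 'I_(nvar Psi).
Implicit Types (u v w x y : V) (p q : seq V) (d : int).

Definition excess v : int := (beta v)%:Z - 1.

Lemma excess01 v : excess v = 0 \/ excess v = 1.
Proof.
by rewrite /excess; have := beta_12 v; rewrite !inE => /orP[] /eqP ->; [left|right].
Qed.

Lemma beta_excess v : (beta v)%:Z = excess v + 1.
Proof. by rewrite /excess subrK. Qed.

Lemma adjC u v : adj u v = adj v u.
Proof. by rewrite /adj /= orbC. Qed.

Lemma looping_gt0 x p : looping x p -> (0 < size p)%N.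
Proof. by elim=> // y r s _ _ _ r0 _ _; rewrite size_cat addn_gt0 r0. Qed.

Lemma interior_cat x p q : (0 < size p)%N -> (0 < size q)%N ->
  interior x (p ++ q) = interior x p ++ last x p :: interior (last x p) q.
Proof.
by case: p q => [|a p] [|b q] // _ _; rewrite /interior /= belast_cat /=.
Qed.

Lemma lambda_cat x p q : (0 < size p)%N -> (0 < size q)%N ->
  lambda x (p ++ q) =
  lambda x p + lambda (last x p) q - 2 * excess (last x p).
Proof.
(* Hiding the sum behind [S] leaves a linear goal. *)
move=> p0 q0; have [S [lambdaE S_cat]] : exists S : seq V -> int,
    (forall y r, lambda y r = (size r)%:Z - 2 * S (interior y r)) /\
    (forall s z t, S (s ++ z :: t) = S s + (excess z + S t)).
  exists (fun s => \sum_(z <- s) excess z); split=> [//|s z t].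
  by rewrite big_cat big_cons.
rewrite !lambdaE interior_cat // size_cat S_cat.
move: (S _) (S _) (excess _) => a b c; lia.
Qed.

Lemma looping_interior x p z : looping x p -> z \in interior x p ->
  (x < z)%N /\ (last x p < z)%N.
Proof. by case=> // {}x {}p q _ lt_int _ _; apply: lt_int. Qed.

(** Interior vertices of either part come after the meeting vertex, hence after both ends; so the
    order need only be checked at the meeting vertex. *)
Lemma looping_join x p q : x != last x (p ++ q) ->
  (x < last x p)%N -> (last x (p ++ q) < last x p)%N ->
  looping x p -> looping (last x p) q -> looping x (p ++ q).
Proof.
move=> xy xm ym lp lq; apply: looping_cat => // z.
rewrite interior_cat ?(looping_gt0 lp) ?(looping_gt0 lq) //.
rewrite last_cat in xy ym *.
rewrite mem_cat inE => /or3P[/(looping_interior lp)|/eqP ->|/(looping_interior lq)] //; lia.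
Qed.

Lemma looping_rev x p : looping x p ->
  exists q, [/\ looping (last x p) q, last (last x p) q = x,
    size q = size p & perm_eq (interior (last x p) q) (interior x p)].
Proof.
elim=> {x p} [x y xy x_y|x p q xy lt_int lp [p' [lp' ep sp pp]] lq [q' [lq' eq sq pq]]].
  by exists [:: x]; split=> //=; apply: looping_edge; rewrite 1?adjC // eq_sym.
have [p0 q0] := (looping_gt0 lp, looping_gt0 lq).
have [p'0 q'0] := (looping_gt0 lp', looping_gt0 lq').
rewrite last_cat in xy lt_int *; exists (q' ++ p').
have perm_int : perm_eq (interior (last (last x p) q) (q' ++ p')) (interior x (p ++ q)).
  apply/permP => a; rewrite !interior_cat // eq !count_cat /=.
  by rewrite (permP pp) (permP pq) addnCA [RHS]addnCA (addnC (count _ _)).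
have perm_int' := perm_mem perm_int.
split=> //; last 2 first.
- by rewrite last_cat eq ep.
- by rewrite !size_cat sq sp addnC.
apply: looping_cat; rewrite ?last_cat ?eq ?ep //; first by rewrite eq_sym.
by move=> z; rewrite perm_int' => /lt_int[].
Qed.

Lemma weight_sym u v d : looping_weight u v d -> looping_weight v u d.
Proof.
case=> p [lp <- <-]; have [q [lq eq sq pq]] := looping_rev lp.
by exists q; split=> //; rewrite /lambda sq (perm_big _ pq).
Qed.

(** A triangle inequality for [delta], sharpened by the cost of the middle vertex. *)
Lemma weight_cat u w v d e : u != v -> (u < w)%N -> (v < w)%N ->
  looping_weight u w d -> looping_weight w v e ->
  looping_weight u v (d + e - 2 * excess w).
Proof.
move=> uv uw vw [p [lp pw <-]] [q [lq qv <-]]; subst w v.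
exists (p ++ q); rewrite last_cat; split=> //.
  by apply: looping_join; rewrite ?last_cat.
by rewrite lambda_cat ?(looping_gt0 lp) ?(looping_gt0 lq).
Qed.

Lemma weight_adj u v : adj u v -> u != v -> looping_weight u v 1.
Proof.
move=> uv u_v; exists [:: v]; split=> //; first exact: looping_edge.
by rewrite /lambda /interior big_nil mulr0 subr0.
Qed.

(** The correction in [lambda] is even, so only the length of the walk matters modulo 2. *)
Lemma weight_parity (c : V -> int) :
  (forall u v, adj u v -> (2 %| c u + c v + 1)%Z) ->
  forall u v d, looping_weight u v d -> (2 %| c u + c v + d)%Z.
Proof.
move=> c_adj u v _ [p [lp <- <-]];
elim: lp => {u v p} [x y /c_adj + _|x p q _ _ lp IHp lq IHq].
  by rewrite /lambda /interior big_nil mulr0 subr0.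
rewrite lambda_cat ?(looping_gt0 lp) ?(looping_gt0 lq) // last_cat.
move: (lambda x p) (lambda _ q) (excess _) (c x) (c (last x p)) (c (last _ q))
  IHp IHq => *; lia.
Qed.

Lemma bigmaxe_attained (I : finType) (P : pred I) (F : I -> \bar int) :
  (\big[maxe/-oo]_(i | P i) F i)%E = -oo%E \/
  exists2 i, P i & (\big[maxe/-oo]_(i | P i) F i)%E = F i.
Proof.
elim/big_rec: _ => [|i x Pi [->|[j Pj ->]]]; first by left.
  by right; exists i; rewrite ?maxeNy.
by right; case: (leP (F i) (F j)) => _; [exists j|exists i].
Qed.

Definition gamma'_val v : int := fine (gamma' v).

(** Finiteness is assumed only below v, so that [gamma'_valE] can derive it everywhere by induction.
    The last clause records whether the outer maximum is 0 or is attained by some u. *)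
Lemma gamma'_cases v :
  (forall u, (u < v)%N -> gamma' u = (gamma'_val u)%:E) ->
  exists z : int, [/\ gamma' v = z%:E, excess v <= z,
    forall u d, (u < v)%N -> looping_weight u v d ->
      gamma'_val u - d + 2 * excess v <= z &
    z = excess v \/
    exists u d, [/\ (u < v)%N, looping_weight u v d &
                    z = gamma'_val u - d + 2 * excess v]].
Proof.
move=> fin_lt; rewrite gamma'E -/(excess v).
pose F u := (gamma' u - delta u v + (excess v)%:E)%E.
rewrite -/(F _); set M := (\big[_/_]_(_ | _) _)%E.
have FE u d : (u < v)%N -> least_weight u v d -> F u = (gamma'_val u - d + excess v)%:E.
  move=> uv dP; rewrite /F fin_lt //.
  have [[e eP ->]|[/(_ d)]] := delta_cases u v; last by case; case: dP.
  have -> : e = d by apply/eqP; rewrite eq_le (eP.2 _ dP.1) (dP.2 _ eP.1).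
  by rewrite -EFinB -EFinD.
have leM u d : (u < v)%N -> looping_weight u v d ->
    ((gamma'_val u - d + excess v)%:E <= M)%E.
  move=> uv dP; have [[e eP _]|[/(_ d)] //] := delta_cases u v.
  apply: (@le_trans _ _ (F u)); last exact: (le_bigmax_cond _ F uv).
  by rewrite (FE u e) // lee_fin; have := eP.2 _ dP; lia.
have : M = -oo%E \/ exists u d, [/\ (u < v)%N, looping_weight u v d &
    M = (gamma'_val u - d + excess v)%:E].
  have [MN|[u uv MF]] : M = -oo%E \/ exists2 u : V, (u < v)%N & M = F u.
  - exact: bigmaxe_attained.
  - by left.
  have [[e eP _]|[_ de]] := delta_cases u v; [right|left].
    by exists u, e; split; [|case: eP|rewrite MF (FE u e)].
  by rewrite MF /F de fin_lt.
case=> [MN|[u [d [uv dP ME]]]].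
  exists (excess v); rewrite MN maxeNy adde0; split=> //; last by left.
  by move=> u d uv /leM -/(_ uv); rewrite MN.
exists (excess v + Num.max 0 (gamma'_val u - d + excess v)).
rewrite ME -EFin_max -EFinD; split=> //.
- by rewrite lerDl le_max lexx.
- move=> w e wv /leM -/(_ wv); rewrite ME lee_fin; lia.
- case: (leP 0 (gamma'_val u - d + excess v)) => h; last by left; rewrite addr0.
  by right; exists u, d; split=> //; lia.
Qed.

Lemma gamma'_valE v : gamma' v = (gamma'_val v)%:E.
Proof.
have [k] := ubnP (v : nat); elim: k v => // k IH v; rewrite ltnS => vk.
have [|z [vz _ _ _]] := @gamma'_cases v; last by rewrite /gamma'_val vz.
by move=> u uv; apply: IH; apply: leq_trans vk.
Qed.

Lemma gamma'_val_spec v : [/\ excess v <= gamma'_val v,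
  forall u d, (u < v)%N -> looping_weight u v d ->
    gamma'_val u - d + 2 * excess v <= gamma'_val v &
  gamma'_val v = excess v \/
  exists u d, [/\ (u < v)%N, looping_weight u v d &
                  gamma'_val v = gamma'_val u - d + 2 * excess v]].
Proof.
have [z [+ *]] := @gamma'_cases v (fun u _ => gamma'_valE u).
by rewrite gamma'_valE => -[->].
Qed.

End Walks.

(** * Truth as a game: positions, continuations, strategies *)

Section Games.
Variables (B : eqType) (E : rel B) (Psi : instance).
Local Notation V := 'I_(nvar Psi).
Implicit Types (f : V -> B) (v : V) (t : nat).

Definition holds_at t f := holds_from E (drop t (enum V)) f.

Lemma drop_enum_ord v : drop v (enum V) = v :: drop v.+1 (enum V).
Proof. by rewrite (drop_nth v) ?size_enum_ord ?ltn_ord // nth_ord_enum. Qed.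

Lemma holds_atE v f :
  holds_at v f = at_least (beta v) (fun b => holds_at v.+1 [eta f with v |-> b]).
Proof. by rewrite /holds_at drop_enum_ord. Qed.

Lemma beta_gt0 v : (0 < beta v)%N.
Proof. by have := beta_12 v; rewrite !inE => /orP[] /eqP ->. Qed.

Lemma models_holds : models E Psi -> forall f, holds_at 0 f.
Proof. by move=> m f; rewrite /holds_at drop0; apply: m. Qed.

Lemma holds_at_end f : holds_at (nvar Psi) f -> forall e, e \in atoms Psi -> E (f e.1) (f e.2).
Proof. by rewrite /holds_at drop_oversize // size_enum_ord. Qed.

Lemma holds_advance t t' f : (t <= t')%N -> holds_at t f ->
  exists2 f', (forall u : V, (u < t)%N -> f' u = f u) & holds_at t' f'.
Proof.
elim: t' => [|t' IH]; first by rewrite leqn0 => /eqP -> ?; exists f.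
rewrite leq_eqVlt => /orP[/eqP <- ?|]; first by exists f.
rewrite ltnS => tt' /(IH tt') [f1 f1f].
have [t'n|nt'] := ltnP t' (nvar Psi); last first.
  rewrite /holds_at !drop_oversize ?size_enum_ord ?(leq_trans nt') // => h.
  by exists f1.
rewrite (holds_atE (Ordinal t'n)) => -[s [_ ss hs]].
have := beta_gt0 (Ordinal t'n); rewrite -ss.
case: s hs {ss} => // b r /(_ b (mem_head _ _)) hb _.
exists [eta f1 with Ordinal t'n |-> b] => // u ut /=.
by rewrite ifN ?f1f //; apply/eqP => uE; move: ut; rewrite uE /= ltnNge tt'.
Qed.

(** The form in which Adversary's choice is used: two continuations of one position that part at v
    if two elements are offered there. *)
Lemma two_picks t v f : (t <= v)%N -> holds_at t f -> exists g h : V -> B,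
  [/\ forall u : V, (u < t)%N -> g u = f u /\ h u = f u,
      beta v = 2%N -> g v <> h v, holds_at v.+1 g & holds_at v.+1 h].
Proof.
move=> tv /(holds_advance tv)[f' f'f]; rewrite holds_atE => -[s [us ss hs]].
have [c [d [cs ds c_d]]] : exists c d,
    [/\ c \in s, d \in s & beta v = 2%N -> c <> d].
  have := beta_12 v; rewrite !inE -ss => /orP[] /eqP.
    by case: s us {ss hs} => [|c [|]] // _ _; exists c, c; rewrite mem_head.
  case: s us {ss hs} => [|c [|d []]] //= /andP[+ _] _; rewrite mem_seq1 => /eqP.
  by exists c, d; rewrite !inE !eqxx orbT.
exists [eta f' with v |-> c], [eta f' with v |-> d].
split; [|by rewrite /= eqxx|exact: hs|exact: hs].
move=> u ut /=; have /negPf -> : u != v by rewrite neq_ltn (leq_trans ut tv).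
by rewrite f'f.
Qed.

Lemma historyE f v : history f v = [seq f u | u <- take v (enum V)].
Proof.
rewrite (subseq_uniqP (enum_uniq V) (take_subseq _ v)); congr (map _ _).
by apply: eq_filter => u; rewrite in_take ?mem_enum // index_enum_ord.
Qed.

Lemma size_history f v : size (history f v) = v.
Proof. by rewrite historyE size_map size_takel // size_enum_ord ltnW. Qed.

Lemma nth_history f v b0 (u : V) :
  nth b0 (history f v) u = if (u < v)%N then f u else b0.
Proof.
have [uv|vu] := ltnP u v; last by rewrite nth_default ?size_history.
have u_lt : (u < size (take v (enum V)))%N.
  by rewrite size_takel // size_enum_ord ltnW.
by rewrite historyE (nth_map u) // nth_take // nth_ord_enum.
Qed.

Lemma models_Prover_wins (b0 b1 : B) : b0 != b1 -> symmetric E ->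
  models E Psi -> Prover_wins E Psi.
Proof.
move=> b01 E_sym E_models.
pose pos (h : seq B) (u : V) := nth b0 h u.
have offer (vh : V * seq B) : exists r : seq B,
    [/\ uniq r, size r = beta vh.1 & holds_at vh.1 (pos vh.2) ->
      forall b, b \in r -> holds_at vh.1.+1 [eta pos vh.2 with vh.1 |-> b]].
  case: vh => v h /=; have [|no] := pselect (holds_at v (pos h)).
    by rewrite holds_atE => -[r [ur sr hr]]; exists r.
  (* A legal strategy must also answer in lost positions; any distinct elements serve there. *)
  have := beta_12 v; rewrite !inE => /orP[] /eqP ->.
    by exists [:: b0]; split.
  by exists [:: b0; b1]; split; rewrite //= mem_seq1 b01.
have [sigma sigmaP] := choice offer.
exists (fun v h => sigma (v, h)) => [v h _|f f_play].
  by have [] := sigmaP (v, h).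
(* The default [b0] matches the one in [pos], so [g t] is the assignment that the strategy reads off
   the history. *)
pose g t (u : V) := if (u < t)%N then f u else b0.
have hold t : (t <= nvar Psi)%N -> holds_at t (g t).
  elim: t => [_|t IH tn]; first exact: models_holds.
  pose v := Ordinal tn.
  have gE : g t = pos (history f v).
    by apply/funext => u; rewrite /pos nth_history.
  have [_ _ /=] := sigmaP (v, history f v); rewrite -gE.
  move=> /(_ (IH (ltnW tn)) _ (f_play v)).
  congr (holds_at _ _); apply/funext => u;
  rewrite /g /= -val_eqE /= [(u < t.+1)%N]ltnS [(u <= t)%N]leq_eqVlt.
  by case: eqP => //= uv; congr f; apply: val_inj.
have f_atoms e : e \in atoms Psi -> E (f e.1) (f e.2).
  by move/(holds_at_end (hold _ (leqnn _))); rewrite /g !ltn_ord.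
by move=> u v /orP[] /f_atoms //; rewrite E_sym.
Qed.

(** Backward induction on the number of variables left, over partial plays that follow the
    strategy. *)
Lemma Prover_wins_models : Prover_wins E Psi -> models E Psi.
Proof.
case=> sigma sigma_legal sigma_wins.
suff hold t f : (t <= nvar Psi)%N ->
    (forall v, (v < t)%N -> f v \in sigma v (history f v)) -> holds_at t f.
  by move=> f; rewrite -[enum _]drop0; apply: hold.
move=> tn; rewrite -(subKn tn).
elim: (nvar Psi - t)%N (leq_subr t (nvar Psi)) f => [_|k IH kn] f fP.
  rewrite subn0 in fP *; rewrite /holds_at drop_oversize ?size_enum_ord //= => -[u v] uv.
  by apply: (sigma_wins f) => [w|]; [apply: fP|rewrite /adj /= uv].
have lt_n : (nvar Psi - k.+1 < nvar Psi)%N by lia.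
pose v := Ordinal lt_n.
have vS : (nvar Psi - k = v.+1)%N by rewrite /=; lia.
rewrite (holds_atE v).
have [us ss] := sigma_legal v _ (size_history f v).
exists (sigma v (history f v)); split=> // b bP.
rewrite -vS; apply: IH; first by lia.
move=> w; rewrite vS ltnS leq_eqVlt => wv.
have -> : history [eta f with v |-> b] w = history f w.
  apply/eq_in_map => u; rewrite mem_filter => /andP[uw _] /=.
  rewrite ifN //; apply/eqP => uv; move: wv uw; rewrite uv; lia.
move: wv => /orP[/eqP/val_inj -> /=|wv]; first by rewrite eqxx.
rewrite /= ifN; first exact: fP.
by apply/eqP => wE; rewrite wE ltnn in wv.
Qed.

End Games.

(** * What Adversary can force on a board embedded in the integers *)

Section Adversary.
Variables (B : eqType) (E : rel B) (Psi : instance) (pos : B -> int).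
Hypothesis pos_inj : injective pos.
Hypothesis pos_edge : forall b c, E b c -> `|pos b - pos c| = 1.
Local Notation V := 'I_(nvar Psi).
Implicit Types (f : V -> B) (u v w : V) (d : int).
Local Notation holds_at := (holds_at E).

Lemma holds_edge f u v t : adj u v -> (u < t)%N -> (v < t)%N -> (t <= nvar Psi)%N ->
  holds_at t f -> `|pos (f u) - pos (f v)| = 1.
Proof.
move=> uv ut vt tn /(holds_advance tn)[f' f'E] /holds_at_end f'P.
rewrite -!f'E //; case/orP: uv => /f'P /= /pos_edge //.
by rewrite distrC.
Qed.

(** Both picks for the middle vertex y satisfy the bounds of both halves. If they are distinct,
    equal parity puts them at least 2 apart, and comparing each end with the pick farther from it
    saves the 2 that [lambda] subtracts. *)
Lemma looping_distance x p f : looping x p ->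
  holds_at (maxn x (last x p)).+1 f ->
  `|pos (f x) - pos (f (last x p))| <= lambda x p /\
  (2 %| pos (f x) - pos (f (last x p)) - lambda x p)%Z.
Proof.
move=> lp; elim: lp f => {x p} [x y xy _|x p q x_z lt_int lp IHp lq IHq] f.
  move/(holds_edge xy); rewrite /lambda /interior big_nil mulr0 subr0 /=.
  rewrite !ltnS leq_maxl leq_maxr gtn_max !ltn_ord => /(_ isT isT isT).
  by move: (pos _) (pos _) => a b; lia.
have [p0 q0] := (looping_gt0 lp, looping_gt0 lq).
have [xy zy] : (x < last x p)%N /\ (last x (p ++ q) < last x p)%N.
  by apply: lt_int; rewrite interior_cat // mem_cat mem_head orbT.
rewrite lambda_cat // {lt_int} last_cat in x_z zy *.
set y := last x p in xy zy lq IHp IHq *; set z := last y q in x_z zy IHq *.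
have : (maxn x z < y)%N by rewrite gtn_max xy.
move=> /two_picks tp /tp {tp} [g [h [ghf g_h hg hh]]].
have [gx hx] := ghf x (leq_maxl x z : x < (maxn x z).+1)%N.
have [gz hz] := ghf z (leq_maxr x z : z < (maxn x z).+1)%N.
rewrite (maxn_idPr (ltnW xy)) in IHp; rewrite (maxn_idPl (ltnW zy)) in IHq.
have [[g1 g2] [g3 g4]] := (IHp _ hg, IHq _ hg).
have [[h1 h2] [h3 h4]] := (IHp _ hh, IHq _ hh).
rewrite gx gz hx hz in g1 g2 g3 g4 h1 h2 h3 h4.
have : excess y = 0 \/ excess y = 1 /\ pos (g y) <> pos (h y).
  have := beta_excess y; have [->|->] := excess01 y => be; [by left|right].
  by split=> // /pos_inj; apply: g_h; lia.
move: (excess y) (lambda x p) (lambda y q) (pos (f x)) (pos (f z)) (pos (g y))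
  (pos (h y)) g1 g2 g3 g4 h1 h2 h3 h4 => *; lia.
Qed.

Lemma weight_distance u v d f : (u < v)%N -> looping_weight u v d ->
  holds_at v.+1 f ->
  `|pos (f u) - pos (f v)| <= d /\ (2 %| pos (f u) - pos (f v) - d)%Z.
Proof.
move=> uv [p [lp pv <-]] h; subst v; apply: looping_distance => //.
by rewrite (maxn_idPr (ltnW uv)).
Qed.

(** Two distinct picks for v cannot both lie at distance 0 from u. *)
Lemma weight_ge_excess u v d (b0 : B) : models E Psi ->
  (u < v)%N -> looping_weight u v d -> excess v <= d.
Proof.
move=> E_models uv dP.
have [f _] := holds_advance (leq0n v) (models_holds E_models (fun=> b0)).
move=> /(two_picks (leqnn v))[g [h [ghf g_h hg hh]]].
have [gu hu] := ghf u uv.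
have [[g1 _] [h1 _]] := (weight_distance uv dP hg, weight_distance uv dP hh).
have : excess v = 0 \/ excess v = 1 /\ pos (g v) <> pos (h v).
  have := beta_excess v; have [->|->] := excess01 v => be; [by left|right].
  by split=> // /pos_inj; apply: g_h; lia.
rewrite gu hu in g1 h1; move: (pos (f u)) (pos (g v)) (pos (h v)) (excess v) g1 h1 => *; lia.
Qed.

(* The first pick is prescribed, because its parity decides which of the two  *)
(* conflicting vertices Adversary aims at.                                    *)
Lemma Adversary_forces (v0 v : V) f : v0 = 0%N :> nat -> holds_at 1 f ->
  gamma'_val v0 <= `|pos (f v0)| ->
  exists2 g, g v0 = f v0 & holds_at v.+1 g /\ gamma'_val v <= `|pos (g v)|.
Proof.
move=> v00 hf fv0; have [k] := ubnP (v : nat); elim: k v => // k IH v.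
rewrite ltnS => vk; have [v0v|v_gt0] := posnP v.
  have -> : v = v0 by apply: val_inj; rewrite /= v00.
  by exists f; rewrite ?v00.
have far g h : (beta v = 2%N -> g v <> h v) ->
    excess v = 0 \/ excess v = 1 /\ pos (g v) <> pos (h v).
  have := beta_excess v; have [->|->] := excess01 v => be gh; [by left|right].
  by split=> // /pos_inj; apply: gh; lia.
have [_ _ [vE|[u [d [uv dP vE]]]]] := gamma'_val_spec v.
  (* Of two distinct picks, one is off the centre. *)
  have [g [h [ghf /far g_h hg hh]]] := two_picks v_gt0 hf.
  have [gu hu] : g v0 = f v0 /\ h v0 = f v0 by apply: ghf; rewrite v00.
  have [gv|gv] := leP (gamma'_val v) `|pos (g v)|; first by exists g.
  by exists h => //; split=> //; rewrite vE in gv *; lia.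
have [f' f'0 [hf' f'u]] := IH u (leq_trans uv vk).
(* Both picks lie within d of u and have the same parity; if distinct, the outer one gains 2 over
   the worst case. *)
have [g [h [ghf /far g_h hg hh]]] := two_picks uv hf'.
have [gu hu] := ghf u (ltnSn u).
have [gv0 hv0] : g v0 = f' v0 /\ h v0 = f' v0 by apply: ghf; rewrite v00.
have [[g1 g2] [h1 h2]] := (weight_distance uv dP hg, weight_distance uv dP hh).
rewrite gu hu in g1 g2 h1 h2.
have [gv|gv] := leP (gamma'_val v) `|pos (g v)|; first by exists g => //; rewrite gv0.
exists h; first by rewrite hv0.
split=> //; rewrite vE in gv *; move: (gamma'_val u) (excess v) (pos (g v)) (pos (h v))
 (pos (f' u)) g1 g2 h1 h2 f'u g_h gv => *; lia.
Qed.

End Adversary.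

(** * Prover's invariant on the path centred at 0 *)

Section Prover.
Variables (m : nat) (Psi : instance).
Local Notation V := 'I_(nvar Psi).
Local Notation B := 'I_m.*2.+1.
Implicit Types (f : V -> B) (u v w : V) (d : int).

Definition centred (b : B) : int := (b : nat)%:Z - m%:Z.

Lemma centred_inj : injective centred.
Proof. by move=> b c; rewrite /centred => bc; apply: ord_inj; lia. Qed.

Lemma centred_edge b c : path_graph _ b c = (`|centred b - centred c| == 1).
Proof.
rewrite /path_graph /centred /=; case: b c => b _ [c _] /=.
by apply/idP/idP => h; lia.
Qed.

Lemma centred_onto (z : int) : `|z| <= m%:Z -> exists b, centred b = z.
Proof.
move=> zm; have lt : (absz (z + m%:Z)%R < m.*2.+1)%N by lia.
by exists (Ordinal lt); rewrite /centred /=; lia.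
Qed.

(** [radius] stands for [gamma'] rounded to a parity that alternates along edges; the hypotheses are
    all that the strategy needs of it. *)
Variable radius : V -> int.
Hypothesis radius_excess : forall v, excess v <= radius v.
Hypothesis radius_le : forall v, radius v <= m%:Z.
Hypothesis radius_step : forall u v d, (u < v)%N -> looping_weight u v d ->
  radius u - d + 2 * excess v <= radius v.
Hypothesis radius_adj : forall u v, adj u v -> (2 %| radius u + radius v + 1)%Z.
Hypothesis adj_neq : forall u v, adj u v -> u != v.
Hypothesis weight_ge : forall u v d, (u < v)%N -> looping_weight u v d -> excess v <= d.

Definition safe (t : nat) f : Prop :=
  (forall u, (u < t)%N -> `|centred (f u)| <= radius u /\
                          (2 %| centred (f u) - radius u)%Z) /\
  (forall u v d, u != v -> (u < t)%N -> (v < t)%N -> looping_weight u v d ->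
     `|centred (f u) - centred (f v)| <= d).

Definition safe_value f v (z : int) : Prop :=
  [/\ `|z| <= radius v, (2 %| z - radius v)%Z &
      forall u d, (u < v)%N -> looping_weight u v d -> `|centred (f u) - z| <= d].

Lemma safe_extend f v b : safe v f -> safe_value f v (centred b) ->
  safe v.+1 [eta f with v |-> b].
Proof.
move=> [f_radius f_dist] [z_radius z_parity z_dist]; split=> [u|u w d u_w] /=.
  rewrite ltnS leq_eqVlt => /orP[/eqP/val_inj ->|uv]; first by rewrite eqxx.
  by rewrite ifN ?neq_ltn ?uv //; apply: f_radius.
rewrite ltnS leq_eqVlt => /orP[/eqP/val_inj uE|uv]; last first.
  rewrite ltnS leq_eqVlt => /orP[/eqP/val_inj ->|wv] dP.
    by rewrite eqxx ifN ?neq_ltn ?uv //; apply: z_dist.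
  by rewrite !ifN ?neq_ltn ?uv ?wv //; apply: f_dist.
rewrite uE eqxx in u_w *; rewrite ltnS leq_eqVlt.
case/orP=> [/eqP/val_inj wv|wv /weight_sym dP]; first by rewrite wv eqxx in u_w.
by rewrite eq_sym (negPf u_w) distrC; apply: z_dist.
Qed.

Lemma helly_int (I : finType) (i0 : I) (lo hi : I -> int) (k : int) :
  (forall i j, lo i + k <= hi j) ->
  exists i, forall j, lo j <= lo i /\ lo i + k <= hi j.
Proof.
move=> lohi; exists [arg max_(i > i0) lo i]%O.
by case: arg_maxP => // i _ i_max j; split; [apply: i_max|apply: lohi].
Qed.

(** Helly on the line: the largest lower end starts a segment of length 2 * [excess v] inside every
    interval, and its two ends are the offers. *)
Lemma safe_values f v : safe v f ->
  exists a, safe_value f v a /\ safe_value f v (a + 2 * excess v).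
Proof.
move=> [f_radius f_dist].
pose D u : int := fine (delta u v).
have D_min u d : looping_weight u v d -> looping_weight u v (D u) /\ D u <= d.
  move=> dP; rewrite /D; have [[e [eP e_min] ->]|[/(_ d)] //] := delta_cases u v.
  by split=> //; apply: e_min.
pose near u : bool := (u < v)%N && `[< exists d, looping_weight u v d >].
pose lo u : int := if near u then centred (f u) - D u else - radius v.
pose hi u : int := if near u then centred (f u) + D u else radius v.
(* Every index that is not near, v itself included, carries the interval of the radius
   constraint. *)
have near_cases u : (near u = false /\ (lo u = - radius v /\ hi u = radius v)) \/
    [/\ (u < v)%N, looping_weight u v (D u), lo u = centred (f u) - D u &
        hi u = centred (f u) + D u].
  rewrite /lo /hi; case: ifP => [|_]; last by left.
  by case/andP=> uv /asboolP[d /D_min[]]; right.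
have lohi u w : lo u + 2 * excess v <= hi w.
  have rv := radius_excess v.
  have [[_ [-> _]]|[uv uP -> _]] := near_cases u;
  have [[_ [_ ->]]|[wv wP _ ->]] := near_cases w.
  - lia.
  - by have [+ _] := f_radius w wv; have := radius_step wv wP; lia.
  - by have [+ _] := f_radius u uv; have := radius_step uv uP; lia.
  have [<-|u_w] := eqVneq u w; first by have := weight_ge uv uP; lia.
  have := f_dist u w _ u_w uv wv (weight_cat u_w uv wv uP (weight_sym wP)).
  by move: (centred _) (centred _) (D u) (D w) (excess v) => *; lia.
have [i imax] := helly_int v lohi.
have lo_parity : (2 %| lo i - radius v)%Z.
  have [[_ [-> _]]|[iv iP -> _]] := near_cases i; first by lia.
  by have [_] := f_radius i iv; have := weight_parity radius_adj iP; lia.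
have [lov hiv] := imax v.
have near_v : near v = false by rewrite /near ltnn.
rewrite /lo near_v -/(lo i) in lov; rewrite /hi near_v in hiv.
have ex0 : 0 <= excess v by have [->|->] := excess01 v.
have safe_between z : lo i <= z -> z <= lo i + 2 * excess v ->
    (2 %| z - radius v)%Z -> safe_value f v z.
  move=> iz zi zr; split=> //; first by lia.
  move=> u d uv dP; have [loi hii] := imax u.
  have near_u : near u by rewrite /near uv; apply/asboolP; exists d.
  have [_ Dd] := D_min u d dP.
  rewrite {1}/lo near_u in loi; rewrite /hi near_u in hii.
  lia.
exists (lo i); split; apply: safe_between; lia.
Qed.

Lemma safe_holds t f : (t <= nvar Psi)%N -> safe t f ->
  holds_at (path_graph m.*2.+1) t f.
Proof.
move=> tn; rewrite -(subKn tn).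
elim: (nvar Psi - t)%N (leq_subr t (nvar Psi)) f => [_|k IH kn] f.
  (* At the end, adjacent vertices are at distance at most 1 and of opposite parity, hence at
     distance exactly 1. *)
  rewrite subn0 => -[f_radius f_dist].
  rewrite /holds_at drop_oversize ?size_enum_ord //= => -[u v] uv /=.
  have uv_adj : adj u v by rewrite /adj /= uv.
  have := f_dist u v 1 (adj_neq uv_adj) (ltn_ord u) (ltn_ord v)
    (weight_adj uv_adj (adj_neq uv_adj)).
  have [_] := f_radius u (ltn_ord u); have [_] := f_radius v (ltn_ord v).
  have := radius_adj uv_adj; have := centred_edge (f u) (f v).
  rewrite /= => ->; lia.
have lt_n : (nvar Psi - k.+1 < nvar Psi)%N by lia.
pose v := Ordinal lt_n.
have vS : (nvar Psi - k = v.+1)%N by rewrite /=; lia.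
move=> f_safe; have [a [a_safe a2_safe]] := @safe_values f v f_safe.
have place z : safe_value f v z -> exists b, centred b = z /\
    holds_at (path_graph m.*2.+1) v.+1 [eta f with v |-> b].
  move=> z_safe; have [z_radius _ _] := z_safe.
  have [b bz] := centred_onto (le_trans z_radius (radius_le v)).
  exists b; split=> //; rewrite -vS; apply: IH; first by lia.
  by rewrite vS; apply: safe_extend => //; rewrite bz.
have [[b [bz hb]] [c [cz hc]]] := (place _ a_safe, place _ a2_safe).
rewrite (holds_atE _ v).
have := beta_excess v; have [vE|vE] := excess01 v; rewrite vE => bv.
  exists [:: b]; split=> //=; first by lia.
  by move=> x; rewrite mem_seq1 => /eqP ->.
exists [:: b; c]; split=> /=; last 1 first.
- by move=> x; rewrite !inE => /orP[] /eqP ->.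
- by rewrite mem_seq1 andbT; apply/eqP => bc; move: bz cz; rewrite bc vE; lia.
- by lia.
Qed.

Lemma safe_models : models (path_graph m.*2.+1) Psi.
Proof. by move=> f; rewrite -[enum _]drop0; apply: safe_holds. Qed.

End Prover.

(** * Colours, parity and the ends of the path *)

Section Bipartite.
Variables (m : nat) (Psi : instance) (black : pred 'I_(nvar Psi)).
Local Notation V := 'I_(nvar Psi).
Hypothesis black_white : proper_colouring black.
Implicit Types (u v : V) (d : int).

Lemma adj_neq u v : adj u v -> u != v.
Proof. by move=> /black_white; apply: contraNneq => ->. Qed.

Lemma centred_le (b : 'I_m.*2.+1) : `|centred b| <= m%:Z.
Proof. by rewrite /centred; have := ltn_ord b; lia. Qed.

Lemma connect_parity (c : V -> int) u v :
  (forall x y, adj x y -> (2 %| c x + c y)%Z) ->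
  connect (@adj Psi) u v -> (2 %| c u + c v)%Z.
Proof.
move=> c_adj /connectP[p + ->]; elim: p u => [|w p IH] u /=; first by lia.
have trans (a b e : int) : (2 %| a + b)%Z -> (2 %| b + e)%Z -> (2 %| a + e)%Z by lia.
by case/andP=> /c_adj uw /IH; apply: trans.
Qed.

Lemma models_gamma'_lt : connected Psi -> models (path_graph m.*2.+1) Psi ->
  forall u v, black u -> ~~ black v ->
  m%:Z <= gamma'_val u -> m%:Z <= gamma'_val v -> False.
Proof.
move=> G_conn E_models u v bu wv um vm.
have pos_edge (b c : 'I_m.*2.+1) : path_graph _ b c -> `|centred b - centred c| = 1.
  by rewrite centred_edge => /eqP.
pose v0 : V := Ordinal (leq_ltn_trans (leq0n u) (ltn_ord u)).
have [g [h [_ g_h hg hh]]] :=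
  two_picks (leqnn v0) (models_holds E_models (fun=> ord0)).
have [f hf fv0] : exists2 f, holds_at (path_graph m.*2.+1) 1 f &
    gamma'_val v0 <= `|centred (f v0)|.
  have -> : gamma'_val v0 = excess v0.
    by have [_ _ [//|[x [d []]]]] := gamma'_val_spec v0; rewrite ltn0.
  have [gv0|gv0] := leP (excess v0) `|centred (g v0)|; first by exists g.
  exists h => //; have := beta_excess v0.
  have [vE|vE] := excess01 v0; rewrite vE in gv0 *; first by lia.
  move=> be; have {}g_h : centred (g v0) <> centred (h v0).
    by move/centred_inj; apply: g_h; lia.
  by move: (centred (g v0)) (centred (h v0)) g_h gv0 => *; lia.
(* The plays aimed at u and at v may differ, but they share the pick at [v0]; it forces m to have a
   parity depending on the colour of w, which cannot hold for both colours. *)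
have forced w : m%:Z <= gamma'_val w ->
    (2 %| m%:Z + (black w)%:Z + (centred (f v0) + (black v0)%:Z))%Z.
  move=> wm; have [f1 f1v0 [hf1 f1w]] :=
    Adversary_forces (@centred_inj m) pos_edge w (erefl : v0 = 0%N :> nat) hf fv0.
  (* The play is completed because the path from w to [v0] may use vertices not yet placed. *)
  have [f2 f2f1 hf2] := holds_advance (ltn_ord w) hf1.
  have f2w : f2 w = f1 w by apply: f2f1.
  have f2v0 : f2 v0 = f v0 by rewrite f2f1.
  have := @connect_parity (fun x => centred (f2 x) + (black x)%:Z) w v0 _ (G_conn w v0).
  rewrite f2w f2v0 => par; have {}par := par _.
  have := centred_le (f1 w); move: par.
  have edge x y : adj x y ->
      (2 %| centred (f2 x) + (black x)%:Z + (centred (f2 y) + (black y)%:Z))%Z.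
    move=> xy; have := holds_edge pos_edge xy (ltn_ord x) (ltn_ord y) (leqnn _) hf2.
    by have := black_white xy; case: (black x); case: (black y) => //= _;
      move: (centred _) (centred _) => *; lia.
  move=> /(_ edge).
  move: (nat_of_bool (black w)) (nat_of_bool (black v0)) (centred (f1 w))
    (centred (f v0)) f1w => *; lia.
have := forced u um; have := forced v vm; rewrite bu (negPf wv) /=.
by move: (centred (f v0)) (nat_of_bool (black v0)) => a b; lia.
Qed.

Lemma gamma'_lt_models : (0 < m)%N ->
  (forall u v d, (u < v)%N -> looping_weight u v d -> excess v <= d) ->
  (forall u v, black u -> ~~ black v ->
    m%:Z <= gamma'_val u -> m%:Z <= gamma'_val v -> False) ->
  models (path_graph m.*2.+1) Psi.
Proof.
move=> m_gt0 weight_ge no_conflict.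
(* [outer] is the colour allowed to reach m. *)
have [outer inner_lt] : exists outer : bool,
    forall v, black v != outer -> gamma'_val v < m%:Z.
  have [[u [bu um]]|no] := pselect (exists u, black u /\ m%:Z <= gamma'_val u).
    exists true => v; rewrite eqb_id => wv; rewrite ltNge; apply/negP => vm.
    exact: (no_conflict u v).
  exists false => v bv; rewrite ltNge; apply/negP => vm; apply: no.
  by exists v; split=> //; case: (black v) bv.
pose par v : int := m%:Z + (black v != outer)%:Z.
have par_adj u v : adj u v -> (2 %| par u + par v + 1)%Z.
  move=> /black_white; rewrite /par.
  by case: (black u); case: (black v); case: outer {inner_lt par} => //= _; lia.
have par_weight := weight_parity par_adj.
(* Since d is at least [excess v], a step can exceed [gamma' u] only when d = 1, and by at most 1;
   then u has the other colour, so it stays below m if v is outer. *)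
have outer_le v : gamma'_val v <= m%:Z.
  have [k] := ubnP (v : nat); elim: k v => // k IH v; rewrite ltnS => vk.
  have [_ _ [->|[u [d [uv dP ->]]]]] := gamma'_val_spec v.
    by have [->|->] := excess01 v; lia.
  have := IH u (leq_trans uv vk); have := weight_ge u v d uv dP.
  have [vo|/inner_lt] := eqVneq (black v) outer; last first.
    have [_ + _] := gamma'_val_spec v => /(_ u d uv dP); lia.
  have := par_weight u v d dP; rewrite /par vo eqxx /=.
  have [uo|/inner_lt] := eqVneq (black u) outer;
    by have [->|->] := excess01 v => /=; lia.
pose radius v : int :=
  if (2 %| gamma'_val v - par v)%Z then gamma'_val v else gamma'_val v + 1.
have radiusP v : (2 %| radius v - par v)%Z /\
    (radius v = gamma'_val v \/ radius v = gamma'_val v + 1 /\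
      ~~ (2 %| gamma'_val v - par v)%Z).
  rewrite /radius; case: ifP => par_v; split; rewrite ?par_v //; [by left|lia|by right].
apply: (@safe_models m Psi radius).
- by move=> v; have [_ rv] := radiusP v; have [g_ge _ _] := gamma'_val_spec v; lia.
- move=> v; have [_] := radiusP v; have := outer_le v; have := inner_lt v; rewrite /par.
  by case: eqP => /= _ => [_|/(_ isT)]; lia.
(* Rounding up respects the recursion, since both sides of the inequality have the same parity. *)
- move=> u v d uv dP; have [_ /(_ u d uv dP) + _] := gamma'_val_spec v.
  have := par_weight u v d dP; have := radiusP u; have := radiusP v.
  move: (radius u) (radius v) (gamma'_val u) (gamma'_val v) (par u) (par v)
    (excess v) => *; lia.
- move=> u v /par_adj; have [+ _] := radiusP u; have [+ _] := radiusP v.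
  move: (radius u) (radius v) (par u) (par v) => *; lia.
- exact: adj_neq.
- exact: weight_ge.
Qed.

End Bipartite.

Theorem theorem30 (n : nat) (Psi : instance) (black : pred 'I_(nvar Psi))
    (n_ge5 : (5 <= n)%N) (n_odd : odd n)
    (G_connected : connected Psi)
    (black_white : proper_colouring black)
    (Pinfty_models : models path_Z Psi) :
  [<-> models (path_graph n) Psi;
       Prover_wins (path_graph n) Psi;
       ~ exists u v : 'I_(nvar Psi),
           [/\ ((n.-1)./2%:Z%:E <= gamma' u)%E,
               ((n.-1)./2%:Z%:E <= gamma' v)%E,
               black u & ~~ black v]].
Proof.
have [m nE m_gt0] : exists2 m, n = m.*2.+1 & (1 < m)%N by exists n./2; lia.
have weight_ge (u v : 'I_(nvar Psi)) (d : int) :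
    (u < v)%N -> looping_weight u v d -> excess v <= d.
  apply: (@weight_ge_excess int path_Z Psi id _ _ u v d 0 Pinfty_models) => //.
  by move=> b c /eqP.
subst n; rewrite /= doubleK.
tfae.
- apply: (@models_Prover_wins _ _ _ (inord 0) (inord 1)).
    by rewrite -val_eqE /= !inordK //; lia.
  by move=> b c; rewrite /path_graph /= orbC.
- move=> /Prover_wins_models E_models [u [v [+ + bu wv]]].
  rewrite !gamma'_valE !lee_fin.
  exact: (models_gamma'_lt black_white G_connected E_models bu wv).
- move=> no; apply: (gamma'_lt_models black_white) => //; first exact: ltnW.
  move=> u v bu wv um vm; apply: no; exists u, v.
  by rewrite !gamma'_valE !lee_fin.
Qed.
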